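(* Let $(A,\circ)$ be a Novikov algebra, $(V,l_A,r_A)$ an $A$-bimodule and $\mathcal A=A\ltimes_{l_{A,\star}^*,-r_A^*}V^*$, with product denoted $\bullet$. Let $\kappa\in\mathbf k$, let $\alpha,\beta\in\mathrm{Hom}_{\mathbf k}(V,A)$, and let $\mathcal P=\alpha^{\mathcal A}$, $\mathcal Q=\beta^{\mathcal A}$, with associated maps $\mathcal P_-,\mathcal Q_+:\mathcal A^*\to\mathcal A$. Suppose that $\mathcal Q_+:\mathcal A^*\to\mathcal A$ is a balanced $\mathcal A$-bimodule homomorphism from $(\mathcal A^*,L_{\mathcal A,\star}^*,-R_{\mathcal A}^* )$ to $(\mathcal A,L_{\mathcal A},R_{\mathcal A})$. Then $\alpha$ is an extended $\mathcal O$-operator of weight $0$ with extension $\beta$ of mass $(\kappa,0)$ on $(A,\circ)$ associated to $(V,l_A,r_A)$ if and only if $\mathcal P_-$ is an extended $\mathcal O$-operator of weight $0$ with extension $\mathcal Q_+$ of mass $(\kappa,0)$ on $(\mathcal A,\bullet)$ associated to $(\mathcal A^*,L_{\mathcal A,\star}^*,-R_{\mathcal A}^* )$.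
   Context: $\mathbf k$ is a field of characteristic zero; all vector spaces are finite-dimensional over $\mathbf k$. A Novikov algebra $(A,\circ)$ is a vector space with a bilinear operation satisfying $(a\circ b)\circ c-a\circ(b\circ c)=(b\circ a)\circ c-b\circ(a\circ c)$ and $(a\circ b)\circ c=(a\circ c)\circ b$ for all $a,b,c\in A$. For any Novikov algebra, $a\star b=a\circ b+b\circ a$, $L_A(a)b=a\circ b$, $R_A(a)b=b\circ a$, $L_{A,\star}=L_A+R_A$ (and likewise $L_{\mathcal A},R_{\mathcal A},L_{\mathcal A,\star}$ for $(\mathcal A,\bullet)$). A bimodule of $(A,\circ)$ (an $A$-bimodule) is $(V,l_A,r_A)$ with $l_A,r_A:A\to\mathrm{End}_{\mathbf k}(V)$ linear and, for all $a,b\in A,v\in V$: $l_A(a\circ b-b\circ a)v=l_A(a)l_A(b)v-l_A(b)l_A(a)v$; $l_A(a)r_A(b)v-r_A(b)l_A(a)v=r_A(a\circ b)v-r_A(b)r_A(a)v$; $l_A(a\circ b)v=r_A(b)l_A(a)v$; $r_A(a)r_A(b)v=r_A(b)r_A(a)v$. For linear $\varphi:A\to\mathrm{End}_{\mathbf k}(V)$, $\varphi^*:A\to\mathrm{End}_{\mathbf k}(V^* )$ is defined by $\langle\varphi^*(a)f,v\rangle=-\langle f,\varphi(a)v\rangle$. Put $l_{A,\star}=l_A+r_A$. Then $(V^*,l_{A,\star}^*,-r_A^* )$ is again a bimodule; in particular $(\mathcal A^*,L_{\mathcal A,\star}^*,-R_{\mathcal A}^* )$ is a bimodule of $\mathcal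 A$. The semi-direct product $\mathcal A=A\ltimes_{l_{A,\star}^*,-r_A^*}V^*$ is the Novikov algebra $A\oplus V^*$ with $(a+f)\bullet(b+g)=a\circ b+l_{A,\star}^*(a)g-r_A^*(b)f$. For $\gamma\in\mathrm{Hom}_{\mathbf k}(V,A)$, identify $\mathcal A^*=A^*\oplus V$ and let $\gamma^{\mathcal A}:\mathcal A^*\to\mathcal A$, $\gamma^{\mathcal A}(a^*+u)=\gamma(u)$ for $a^*\in A^*$, $u\in V$. Put $\gamma^{\mathcal A}_\pm:=\gamma^{\mathcal A}\pm(\gamma^{\mathcal A})^*:\mathcal A^*\to\mathcal A$ where $(\gamma^{\mathcal A})^*:\mathcal A^*\to\mathcal A^{**}\cong\mathcal A$ is the dual map (equivalently, $\gamma^{\mathcal A}_\pm$ corresponds to the tensor $\check\gamma\pm\tau(\check\gamma)\in\mathcal A\otimes\mathcal A$, where $\check\gamma\in V^*\otimes A\subset\mathcal A\otimes\mathcal A$ is the tensor of $\gamma$). Thus $\mathcal P_-=\alpha^{\mathcal A}_-$ and $\mathcal Q_+=\beta^{\mathcal A}_+$. For a bimodule $(V,l_A,r_A)$ and linear $\beta:V\to A$: $\beta$ is balanced if $l_A(\beta(u))v=r_A(\beta(v))u$; it is an $A$-bimodule homomorphism to $(A,L_A,R_A)$ if $\beta(l_A(x)u)=x\circ\beta(u)$ and $\beta(r_A(x)u)=\beta(u)\circ x$; it is $A$-invariant of mass $\kappa$ if these two identities hold after multiplication by $\kappa$. A linear map $\alpha:V\to A$ is an extended $\mathcal O$-operator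 of weight $0$ with extension $\beta$ of mass $(\kappa,0)$ associated to $(V,l_A,r_A)$ if $\beta$ is balanced and $A$-invariant of mass $\kappa$ and $\alpha(u)\circ\alpha(v)-\alpha(l_A(\alpha(u))v+r_A(\alpha(v))u)=\kappa\,\beta(u)\circ\beta(v)$ for all $u,v\in V$. *)

(* Defs.v *)
From HB Require Import structures.
From mathcomp Require Import all_boot all_algebra.
From mathcomp Require Import ring.

Set Implicit Arguments.
Unset Strict Implicit.
Unset Printing Implicit Defensive.

Import GRing.Theory.
Local Open Scope ring_scope.

(* Bilinear operations A x B -> C are elements of 'Hom(A, 'Hom(B, C)), so a    *)
(* product [mu] on A is its own left multiplication operator L_A.  Maps are    *)
(* built with [linfun], which returns the intended map only on linear input;   *)
(* each definition using it is followed by a lemma giving its values.          *)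

Lemma linfunP (k : fieldType) (U W : vectType k) (f : U -> W) :
  linear f -> linfun f =1 f.
Proof.
move=> lf.
pose F : {linear U -> W} := HB.pack f (GRing.isLinear.Build _ _ _ _ f lf).
exact: (lfunE F).
Qed.

Lemma linfun2P (k : fieldType) (U W X : vectType k) (f : U -> W -> X) :
  (forall u, linear (f u)) -> (forall w, linear (f^~ w)) ->
  forall u w, linfun (fun u => linfun (f u)) u w = f u w.
Proof.
move=> lr ll u w; rewrite linfunP ?linfunP // => c x y.
by apply/lfunP => z; rewrite add_lfunE scale_lfunE !linfunP // ll.
Qed.

Section Novikov.

Variable k : fieldType.
Implicit Types A V W : vectType k.

(* Definitions rather than notations: left unfolded, the canonical structures  *)
(* of the nested types occurring below are very slow to unify.                 *)
Definition dual V : vectType k := 'Hom(V, k^o).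
Definition dsum V W : vectType k := (V * W)%type.

Lemma dual_addE V (f g : dual V) v : (f + g) v = f v + g v.
Proof. exact: add_lfunE. Qed.

Lemma dual_oppE V (f : dual V) v : (- f) v = - f v.
Proof. exact: opp_lfunE. Qed.

Lemma dualD V (f : dual V) u v : f (u + v) = f u + f v.
Proof. exact: linearD. Qed.

Lemma dualN V (f : dual V) v : f (- v) = - f v.
Proof. exact: linearN. Qed.

Lemma lfun2B A V W (l : 'Hom(A, 'Hom(V, W))) a b v :
  l (a - b) v = l a v - l b v.
Proof. by rewrite linearB add_lfunE opp_lfunE. Qed.

Definition novikov A (mu : 'Hom(A, 'End(A))) : Prop :=
  (forall a b c : A,
     mu (mu a b) c - mu a (mu b c) = mu (mu b a) c - mu b (mu a c)) /\
  (forall a b c : A, mu (mu a b) c = mu (mu a c) b).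

Definition rmult A (mu : 'Hom(A, 'End(A))) : 'Hom(A, 'End(A)) :=
  linfun (fun a => linfun (fun b => mu b a)).

Lemma rmultE A (mu : 'Hom(A, 'End(A))) a b : rmult mu a b = mu b a.
Proof.
rewrite linfun2P // => [u c x y|w c x y]; rewrite linearP //.
by rewrite add_lfunE scale_lfunE.
Qed.

Definition bimodule A V (mu : 'Hom(A, 'End(A))) (l r : 'Hom(A, 'End(V))) :
    Prop :=
  [/\ forall a b v, l (mu a b - mu b a) v = l a (l b v) - l b (l a v),
      forall a b v, l a (r b v) - r b (l a v) = r (mu a b) v - r b (r a v),
      forall a b v, l (mu a b) v = r b (l a v)
    & forall a b v, r a (r b v) = r b (r a v)].

(* phi^*, with the minus sign of the contragredient representation *)
Definition dualrep A V (phi : 'Hom(A, 'End(V))) : 'Hom(A, 'End(dual V)) :=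
  linfun (fun a => linfun (fun f : dual V => - (f \o phi a)%VF : dual V)).

Lemma dualrepE A V (phi : 'Hom(A, 'End(V))) a (f : dual V) v :
  dualrep phi a f v = - f (phi a v).
Proof.
rewrite linfun2P ?opp_lfunE ?comp_lfunE // => [u|w] c x y;
  apply/lfunP => z; do !rewrite (opp_lfunE, add_lfunE, scale_lfunE, comp_lfunE).
  by rewrite opprD scalerN.
by rewrite linearP add_lfunE scale_lfunE linearP opprD scalerN.
Qed.

(* The product of A |x_(l, r) W on A * W. *)
Definition semidirect A W (mu : 'Hom(A, 'End(A))) (l r : 'Hom(A, 'End(W))) :
    'Hom(dsum A W, 'End(dsum A W)) :=
  linfun (fun x : dsum A W => linfun (fun y : dsum A W =>
    (mu x.1 y.1, l x.1 y.2 + r y.1 x.2))).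

Lemma semidirectE A W (mu : 'Hom(A, 'End(A))) (l r : 'Hom(A, 'End(W))) x y :
  semidirect mu l r x y = (mu x.1 y.1, l x.1 y.2 + r y.1 x.2).
Proof.
rewrite linfun2P // => {x y} [x|y] c [a f] [b g] /=;
  rewrite !linearP !(add_lfunE, scale_lfunE) /=; apply/pair_equal_spec;
  split=> //=; by rewrite scalerDr addrACA.
Qed.

Definition transpose V W (f : 'Hom(V, W)) : 'Hom(dual W, dual V) :=
  linfun (fun g : dual W => (g \o f)%VF : dual V).

Lemma transposeE V W (f : 'Hom(V, W)) (g : dual W) v :
  transpose f g v = g (f v).
Proof.
rewrite linfunP ?comp_lfunE // => c x y.
by apply/lfunP => z; rewrite !lfun_simp.
Qed.

Definition bidual W : 'Hom(W, dual (dual W)) :=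
  linfun (fun w => linfun (fun f : dual W => f w)).

Lemma bidualE W w (f : dual W) : bidual W w f = f w.
Proof.
by rewrite linfun2P // => [u|g] c x y; rewrite ?linearP // !lfun_simp.
Qed.

(* The identification V^* (+) W ~ (V (+) W^* )^*, under which h + w is the     *)
(* linear form v + g |-> h(v) + g(w).                                          *)
Definition dual_sum V W : 'Hom(dsum (dual V) W, dual (dsum V (dual W))) :=
  linfun (fun x : dsum (dual V) W =>
    linfun (fun y : dsum V (dual W) => (x.1 y.1 + y.2 x.2 : k^o))).

Lemma dual_sumE V W x y : dual_sum V W x y = x.1 y.1 + y.2 x.2.
Proof.
rewrite linfun2P // => {x y} [x|y] c [a f] [b g] /=;
  by rewrite !linearP !lfun_simp /= scalerDr addrACA.
Qed.

Lemma dual_separates W (w : W) : (forall f : dual W, f w = 0) -> w = 0.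
Proof.
move=> w0; rewrite (coord_vbasis (memvf w)) big1 // => i _.
have := w0 (linfun (coord (vbasis fullv) i : W -> k^o)).
by rewrite lfunE /= => ->; rewrite scale0r.
Qed.

Lemma dual_eq W (w1 w2 : W) : (forall f : dual W, f w1 = f w2) -> w1 = w2.
Proof.
move=> w12; apply/eqP; rewrite -subr_eq0; apply/eqP/dual_separates => f.
by rewrite linearB /= w12 subrr.
Qed.

Lemma bij_lfun V W (f : 'Hom(V, W)) : dim V = dim W -> lker f == 0%VS ->
  cancel f f^-1%VF /\ cancel f^-1%VF f.
Proof.
move=> dVW f0; split; first exact: lker0_lfunK.
move=> w; apply: limg_lfunVK.
suff -> : limg f = fullv by rewrite memvf.
apply/eqP; rewrite eqEdim subvf /= limg_dim_eq ?(eqP f0) ?capv0 //.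
by rewrite !dimvf dVW.
Qed.

Lemma dim_dual W : dim (dual W) = dim W.
Proof. exact: muln1. Qed.

Lemma dim_dsum V W : dim (dsum V W) = (dim V + dim W)%N.
Proof. reflexivity. Qed.

Lemma bidual_bij W :
  cancel (bidual W) (bidual W)^-1%VF /\ cancel (bidual W)^-1%VF (bidual W).
Proof.
apply: bij_lfun; first by rewrite !dim_dual.
apply/lker0P => u v uv; apply/eqP; rewrite -subr_eq0; apply/eqP.
apply: dual_separates => f.
by rewrite linearB /= -(bidualE u) uv bidualE subrr.
Qed.

Lemma dual_sum_bij V W :
  cancel (dual_sum V W) (dual_sum V W)^-1%VF /\
  cancel (dual_sum V W)^-1%VF (dual_sum V W).
Proof.
apply: bij_lfun; first by rewrite !(dim_dual, dim_dsum).
rewrite -subv0; apply/subvP => -[a u]; rewrite memv_ker memv0 => /eqP au0.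
have E (y : dsum V (dual W)) : a y.1 + y.2 u = 0.
  by rewrite -(dual_sumE (a, u) y) au0 zero_lfunE.
apply/eqP; congr (_, _).
  apply/lfunP => b; have := E (b, 0).
  by rewrite /= !zero_lfunE addr0.
by apply: dual_separates => f; have := E (0, f); rewrite /= linear0 add0r.
Qed.

(* gamma^B : B^* -> B for B = A (+) V^* and gamma : V -> A *)
Definition lift A V (gamma : 'Hom(V, A)) :
    'Hom(dual (dsum A (dual V)), dsum A (dual V)) :=
  (linfun (fun x : dsum (dual A) V => (gamma x.2, 0) : dsum A (dual V))
     \o (dual_sum A V)^-1)%VF.

Lemma liftE A V (gamma : 'Hom(V, A)) (f : dual A) (u : V) :
  lift gamma (dual_sum A V (f, u)) = (gamma u, 0).
Proof.
rewrite comp_lfunE (dual_sum_bij A V).1 linfunP // => c x y.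
by rewrite linearP; congr (_, _); rewrite /= scaler0 addr0.
Qed.

(* The transpose of f : W^* -> W, with its target W^** identified with W *)
Definition adjoint W (f : 'Hom(dual W, W)) : 'Hom(dual W, W) :=
  ((bidual W)^-1 \o transpose f)%VF.

Lemma adjointE W (f : 'Hom(dual W, W)) (g h : dual W) :
  h (adjoint f g) = g (f h).
Proof.
by rewrite comp_lfunE -bidualE (bidual_bij W).2 transposeE.
Qed.

Definition lift_minus A V (gamma : 'Hom(V, A)) :=
  lift gamma - adjoint (lift gamma).
Definition lift_plus A V (gamma : 'Hom(V, A)) :=
  lift gamma + adjoint (lift gamma).

Section Operators.

Variables (A V : vectType k) (mu : 'Hom(A, 'End(A))) (l r : 'Hom(A, 'End(V))).

Definition balanced (beta : 'Hom(V, A)) : Prop :=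
  forall u v, l (beta u) v = r (beta v) u.

Definition bimodule_hom (beta : 'Hom(V, A)) : Prop :=
  forall x u, beta (l x u) = mu x (beta u) /\ beta (r x u) = mu (beta u) x.

Definition invariant_of_mass (kappa : k) (beta : 'Hom(V, A)) : Prop :=
  forall x u, kappa *: beta (l x u) = kappa *: mu x (beta u) /\
              kappa *: beta (r x u) = kappa *: mu (beta u) x.

(* Weight 0, with extension beta of mass (kappa, 0) *)
Definition extended_O_operator (kappa : k) (alpha beta : 'Hom(V, A)) : Prop :=
  [/\ balanced beta, invariant_of_mass kappa beta
    & forall u v, mu (alpha u) (alpha v)
                    - alpha (l (alpha u) v + r (alpha v) u)
                  = kappa *: mu (beta u) (beta v)].

End Operators.

(* The bimodule (V^*, (l + r)^*, - r^* ) *)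
Definition dual_l A V (l r : 'Hom(A, 'End(V))) : 'Hom(A, 'End(dual V)) :=
  dualrep (l + r).
Definition dual_r A V (r : 'Hom(A, 'End(V))) : 'Hom(A, 'End(dual V)) :=
  - dualrep r.

Lemma dual_lE A V (l r : 'Hom(A, 'End(V))) a (f : dual V) v :
  dual_l l r a f v = - (f (l a v) + f (r a v)).
Proof. by rewrite dualrepE !add_lfunE linearD. Qed.

Lemma dual_rE A V (r : 'Hom(A, 'End(V))) a (f : dual V) v :
  dual_r r a f v = f (r a v).
Proof. by rewrite !opp_lfunE dualrepE opprK. Qed.

(* The constructions above do produce Novikov algebras and bimodules. *)

Lemma novikov_semidirect A W (mu : 'Hom(A, 'End(A))) (l r : 'Hom(A, 'End(W))) :
  novikov mu -> bimodule mu l r -> novikov (semidirect mu l r).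
Proof.
move=> [N1 N2] [B1 B2 B3 B4]; split=> -[a f] [b g] [c h];
  rewrite !semidirectE /=.
  apply/pair_equal_spec; split; first exact: N1.
  apply: dual_eq => e.
  have := congr1 e (B1 a b h); have := congr1 e (B2 a c g).
  have := congr1 e (B2 b c f).
  rewrite ![in l _ (_ + _)]linearD ![in r _ (_ + _)]linearD /=.
  rewrite ?lfun2B !(dualD, dualN).
  move=> /(canRL (subrK _)) -> /(canRL (subrK _)) -> /(canRL (subrK _)) ->.
  ring.
apply/pair_equal_spec; split; first exact: N2.
apply: dual_eq => e.
rewrite !linearD /= !B3 B4.
ring.
Qed.

Lemma bimodule_regular A (mu : 'Hom(A, 'End(A))) :
  novikov mu -> bimodule mu mu (rmult mu).
Proof.
move=> [N1 N2]; split=> a b c; rewrite ?rmultE //.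
- apply: dual_eq => e; have := congr1 e (N1 a b c).
  rewrite ?lfun2B !(dualD, dualN).
  move=> /(canRL (subrK _)) ->; ring.
- apply: dual_eq => e; have := congr1 e (N1 a c b).
  rewrite ?lfun2B !(dualD, dualN).
  move=> /(canRL (subrK _)) ->; ring.
Qed.

Lemma bimodule_dual A V (mu : 'Hom(A, 'End(A))) (l r : 'Hom(A, 'End(V))) :
  bimodule mu l r -> bimodule mu (dual_l l r) (dual_r r).
Proof.
move=> [B1 B2 B3 B4]; split=> a b f; apply/lfunP => v;
  rewrite ?(dual_addE, dual_oppE) ?(dual_lE, dual_rE).
- have := congr1 f (B1 a b v); have := congr1 f (B2 a b v).
  have := congr1 f (B2 b a v); rewrite (B4 a b v).
  rewrite ?lfun2B !(dualD, dualN).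
  move=> /(canRL (subrK _)) E1 /(canRL (subrK _)) E2 /(canRL (subrK _)) E3.
  by rewrite E1 E2 E3; ring.
- have := congr1 f (B2 a b v); rewrite (B4 a b v).
  rewrite ?lfun2B !(dualD, dualN).
  move=> /(canRL (subrK _)) ->; ring.
- have := congr1 f (B2 a b v); rewrite B3 (B4 a b v).
  rewrite ?lfun2B !(dualD, dualN).
  move=> /(canRL (subrK _)) ->; ring.
- by rewrite B4.
Qed.

End Novikov.

(* Main.v *)
(** With [E u w := alpha u o alpha w - alpha (l (alpha u) w + r (alpha w) u)],
    the defect of [P_-] at [(f, u), (g, v)] in [A^* (+) V] has [A]-component
    [E u v] and [V^*]-component [w |-> f (E w v) - g (E u w + E w u)].
    Balancedness of [Q_+] amounts to [beta] being a balanced bimodule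
    homomorphism, and then [Q_+ (f, u) . Q_+ (g, v)] has the same two components
    with [E u v] replaced by [beta u o beta v]. *)
Require Import Defs.
From mathcomp Require Import all_boot all_algebra.
From mathcomp Require Import ring.

Set Implicit Arguments.
Unset Strict Implicit.
Unset Printing Implicit Defensive.

Import GRing.Theory.
Local Open Scope ring_scope.

Section Lift.

Variables (k : fieldType) (A V : vectType k).
Implicit Types (gamma : 'Hom(V, A)) (H : dual (dsum A (dual V))).

(** Stated for an arbitrary functional [H]: in the operator identity [lift_minus alpha] meets a sum
    of values of [lB] and [rB], whose preimage under [dual_sum] is not explicit. Testing against [g]
    avoids computing it. *)
Lemma lift_fst gamma H (g : dual A) :
  g (Defs.lift gamma H).1 = H (0, transpose gamma g).
Proof.
rewrite -((dual_sum_bij A V).2 H); case: (_ H) => f u.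
by rewrite liftE dual_sumE /= linear0 add0r transposeE.
Qed.

Lemma lift_snd gamma H : (Defs.lift gamma H).2 = 0.
Proof.
by rewrite -((dual_sum_bij A V).2 H); case: (_ H) => f u; rewrite liftE.
Qed.

(** Pairing with [(g, v)] moves [lift gamma] to the other side and leaves [f (gamma v)]. *)
Lemma adjoint_liftE gamma (f : dual A) (u : V) :
  adjoint (Defs.lift gamma) (dual_sum A V (f, u)) = (0, transpose gamma f).
Proof.
apply: dual_eq => h; rewrite adjointE.
rewrite -((dual_sum_bij A V).2 h); case: (_ h) => g v.
by rewrite liftE !dual_sumE /= linear0 zero_lfunE addr0 add0r transposeE.
Qed.

Lemma adjoint_lift_fst gamma H : (adjoint (Defs.lift gamma) H).1 = 0.
Proof.
by rewrite -((dual_sum_bij A V).2 H); case: (_ H) => f u; rewrite adjoint_liftE.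
Qed.

Lemma adjoint_lift_snd gamma H w :
  (adjoint (Defs.lift gamma) H).2 w = H (gamma w, 0).
Proof.
rewrite -((dual_sum_bij A V).2 H); case: (_ H) => f u.
by rewrite adjoint_liftE dual_sumE /= transposeE zero_lfunE addr0.
Qed.

Lemma lift_plusE gamma (f : dual A) (u : V) :
  lift_plus gamma (dual_sum A V (f, u)) = (gamma u, transpose gamma f).
Proof.
by rewrite add_lfunE liftE adjoint_liftE; congr (_, _); rewrite /= ?addr0 ?add0r.
Qed.

Lemma lift_minusE gamma (f : dual A) (u : V) :
  lift_minus gamma (dual_sum A V (f, u)) = (gamma u, - transpose gamma f).
Proof.
rewrite add_lfunE opp_lfunE liftE adjoint_liftE.
by congr (_, _); rewrite /= ?oppr0 ?addr0 ?add0r.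
Qed.

Lemma lift_minus_fst gamma H (g : dual A) :
  g (lift_minus gamma H).1 = H (0, transpose gamma g).
Proof.
by rewrite add_lfunE opp_lfunE /= adjoint_lift_fst oppr0 addr0 lift_fst.
Qed.

Lemma lift_minus_snd gamma H w :
  (lift_minus gamma H).2 w = - H (gamma w, 0).
Proof.
rewrite add_lfunE opp_lfunE /= lift_snd add0r dual_oppE.
by rewrite adjoint_lift_snd.
Qed.

End Lift.

Section Double.

Variables (k : fieldType) (A V : vectType k).
Variables (mu : 'Hom(A, 'End(A))) (l r : 'Hom(A, 'End(V))).

Let muB := semidirect mu (dual_l l r) (dual_r r).
Let lB := dual_l muB (rmult muB).
Let rB := dual_r (rmult muB).

(** The two products of [(a, f)] and [(b, h)] contribute [r]-terms of opposite sign, so only [l]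
    acts on [u]. *)
Lemma double_lE a (f : dual V) (g : dual A) u b (h : dual V) :
  lB (a, f) (dual_sum A V (g, u)) (b, h) =
  - g (mu a b + mu b a) + f (l b u) + h (l a u).
Proof.
rewrite dual_lE rmultE !semidirectE !dual_sumE /=.
rewrite !dual_addE !dual_lE !dual_rE dualD; ring.
Qed.

Lemma double_rE a (f : dual V) (g : dual A) u b (h : dual V) :
  rB (a, f) (dual_sum A V (g, u)) (b, h) =
  g (mu b a) - f (l b u + r b u) + h (r a u).
Proof.
rewrite dual_rE rmultE !semidirectE !dual_sumE /=.
rewrite !dual_addE !dual_lE !dual_rE dualD; ring.
Qed.

Lemma balanced_lift_plus (beta : 'Hom(V, A)) :
  balanced lB rB (lift_plus beta) ->
  balanced l r beta /\ bimodule_hom mu l r beta.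
Proof.
move=> bal.
(* Here [f], [g] and [h] are independent, so each isolates one identity: [f] yields [El] and [h] the
   balancedness of [beta]. *)
have E (f : dual A) u (g : dual A) v b (h : dual V) :
    - g (mu (beta u) b + mu b (beta u)) + f (beta (l b v)) + h (l (beta u) v) =
    f (mu b (beta v)) - g (beta (l b u + r b u)) + h (r (beta v) u).
  have /(congr1 (fun H : dual _ => H (b, h))) :=
    bal (dual_sum A V (f, u)) (dual_sum A V (g, v)).
  by rewrite !lift_plusE double_lE double_rE !transposeE.
have El b u : beta (l b u) = mu b (beta u).
  apply: dual_eq => f; have := E f 0 0 u b 0.
  by rewrite !zero_lfunE oppr0 !addr0 add0r.
split=> [u v|b u].
  apply: dual_eq => h; have := E 0 u 0 v 0 h.
  by rewrite !zero_lfunE oppr0 !add0r.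
(* The [g]-part is the sum of the two homomorphism identities; cancelling [El] leaves the one for
   [r]. *)
split=> //; apply: dual_eq => g; have := E 0 u g 0 b 0.
rewrite !zero_lfunE !addr0 add0r => /oppr_inj.
by rewrite [beta (_ + _)]linearD !dualD /= El addrC => /addrI.
Qed.

Variables (kappa : k) (alpha beta : 'Hom(V, A)).

Let defect u v :=
  mu (alpha u) (alpha v) - alpha (l (alpha u) v + r (alpha v) u).

Let defectB F G :=
  muB (lift_minus alpha F) (lift_minus alpha G)
    - lift_minus alpha (lB (lift_minus alpha F) G + rB (lift_minus alpha G) F).

(** The subtracted term is evaluated at [(0, transpose alpha h)], where all contributions of [f] and
    [g] vanish. *)
Lemma defect_lift_minus_fst f u g v :
  (defectB (dual_sum A V (f, u)) (dual_sum A V (g, v))).1 = defect u v.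
Proof.
apply: dual_eq => h; rewrite /defectB /defect /= !dualD !dualN.
rewrite lift_minus_fst !lift_minusE dual_addE double_lE double_rE.
rewrite semidirectE /= !transposeE.
rewrite ![mu 0]linear0 ![l 0]linear0 ![r 0]linear0 ![mu _ 0]linear0 !zero_lfunE
  !addr0 !linear0 [alpha (_ + _)]linearD dualD /=.
ring.
Qed.

(** The subtracted term is evaluated at [(alpha w, 0)]: [lB] and [rB] supply the products in [A],
    and the terms in [alpha (l _ _)] and [alpha (r _ _)] come partly from them and partly from
    [muB]. *)
Lemma defect_lift_minus_snd f u g v w :
  (defectB (dual_sum A V (f, u)) (dual_sum A V (g, v))).2 w =
  f (defect w v) - g (defect u w + defect w u).
Proof.
rewrite /defectB /= dual_addE dual_oppE.
rewrite lift_minus_snd !lift_minusE dual_addE double_lE double_rE.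
rewrite semidirectE /= dual_addE dual_lE dual_rE !dual_oppE !transposeE.
rewrite !zero_lfunE /defect ![alpha (_ + _)]linearD /= !(dualD, dualN) /=; ring.
Qed.

(** The dual actions put [l] and [r] inside [beta]; the homomorphism property turns these into
    products. *)
Lemma mul_lift_plus_snd f u g v w : bimodule_hom mu l r beta ->
  (muB (lift_plus beta (dual_sum A V (f, u)))
       (lift_plus beta (dual_sum A V (g, v)))).2 w =
  f (mu (beta w) (beta v))
    - g (mu (beta u) (beta w) + mu (beta w) (beta u)).
Proof.
move=> hom; rewrite !lift_plusE semidirectE /= dual_addE dual_lE dual_rE.
have [E1 E2] := hom (beta u) w; have [_ E3] := hom (beta v) w.
by rewrite !transposeE E1 E2 E3 dualD addrC.
Qed.

Lemma extended_O_operator_lift :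
  bimodule_hom mu l r beta ->
  (forall u v, defect u v = kappa *: mu (beta u) (beta v)) <->
  (forall F G, defectB F G =
    kappa *: muB (lift_plus beta F) (lift_plus beta G)).
Proof.
move=> hom; split=> [E F G|E u v]; last first.
  (* The [A]-component alone recovers the identity on [V]. *)
  have /(congr1 fst) := E (dual_sum A V (0, u)) (dual_sum A V (0, v)).
  by rewrite defect_lift_minus_fst !lift_plusE semidirectE.
rewrite -((dual_sum_bij A V).2 F) -((dual_sum_bij A V).2 G).
case: (_ F) (_ G) => f u [g v].
rewrite [LHS]surjective_pairing [RHS]surjective_pairing; congr (_, _).
  by rewrite defect_lift_minus_fst E !lift_plusE semidirectE.
apply/lfunP => w; rewrite defect_lift_minus_snd /= scale_lfunE.
rewrite mul_lift_plus_snd // !E -scalerDr 2!linearZ /=.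
by rewrite -scalerBr.
Qed.

End Double.

Theorem theorem3p16 (k : fieldType) (char0 : [pchar k] =i pred0)
    (A V : vectType k) (mu : 'Hom(A, 'End(A))) (l r : 'Hom(A, 'End(V)))
    (A_novikov : novikov mu) (V_bimodule : bimodule mu l r)
    (kappa : k) (alpha beta : 'Hom(V, A)) :
  let muB : 'Hom(dsum A (dual V), 'End(dsum A (dual V))) :=
    semidirect mu (dual_l l r) (dual_r r) in
  let lB := dual_l muB (rmult muB) in
  let rB := dual_r (rmult muB) in
  balanced lB rB (lift_plus beta) ->
  bimodule_hom muB lB rB (lift_plus beta) ->
  (extended_O_operator mu l r kappa alpha beta <->
   extended_O_operator muB lB rB kappa (lift_minus alpha) (lift_plus beta)).
Proof.
move=> muB lB rB balB homB.
have [bal hom] := balanced_lift_plus balB.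
have O_lift := extended_O_operator_lift kappa alpha hom.
(* Balancedness is at hand on both sides, and a homomorphism is invariant of every mass, so only the
   operator identity is transferred. *)
split=> [[_ _ /O_lift E]|[_ _ /O_lift E]]; split=> // x u.
  by have [-> ->] := homB x u.
by have [-> ->] := hom x u.
Qed.
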